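(* Let $1\le p,q,r\le\infty$ with $\frac1p=\frac1q+\frac1r$. Let $E_1,\dots,E_m,F,G_1,\dots,G_m$ and $H$ be Banach lattices. Let $T\in\mathcal L^{m+}_{w,(q,r)}(E_1,\dots,E_m;F)$, let $u_j:G_j\to E_j$ $(1\le j\le m)$ be positive bounded linear operators and let $v:F\to H$ be a positive bounded linear operator. Then $$v\circ T\circ(u_1,\dots,u_m)\in\mathcal L^{m+}_{w,(q,r)}(G_1,\dots,G_m;H)$$ and $$d^{m+}_{w,(q,r)}\big(v\circ T\circ(u_1,\dots,u_m)\big)\le d^{m+}_{w,(q,r)}(T)\,\|u_1\|\cdots\|u_m\|\,\|v\|.$$
   Context: All Banach lattices are real. $E^+$ is the positive cone of $E$. An $m$-linear operator is positive if it maps tuples of positive elements to positive elements, and regular if it is a difference of two positive ones. $\mathcal L^r(E_1,\dots,E_m)$ is the Banach lattice of regular $m$-linear forms, with norm $\|\,|\varphi|\,\|$, and $B^+_{\mathcal L^r(E_1,\dots,E_m)}$ is the set of positive $m$-linear forms $\varphi$ with $\|\varphi\|\le1$. For a finite sequence $(y_i)_{i=1}^n$ in a Banach lattice $G$, $\|(y_i)_{i=1}^n\|_{r,|w|}=\sup\{(\sum_{i=1}^n\langle \xi,|y_i|\rangle^r)^{1/r}:\xi\in B_{G^*},\ \xi\ge0\}$. $\|\cdot\|_p$ is the $\ell_p^n$ norm. Power sums with exponent $\infty$ are replaced by maxima. Definition. A bounded $m$-linear operator $T:E_1\times\cdots\times E_m\to F$ is positive weakly $(q,r)$-dominated if there is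 $C>0$ such that for all $n$, all $(x_i^1,\dots,x_i^m)\in E_1^+\times\cdots\times E_m^+$ $(1\le i\le n)$ and all $y_1^*,\dots,y_n^*\in F^{*+}$, $$\Big\|\big(\langle T(x_i^1,\dots,x_i^m),y_i^*\rangle\big)_{i=1}^n\Big\|_p\le C\sup_{\varphi\in B^+_{\mathcal L^r(E_1,\dots,E_m)}}\Big(\sum_{i=1}^n\varphi(x_i^1,\dots,x_i^m)^q\Big)^{1/q}\|(y_i^* )_{i=1}^n\|_{r,|w|}.$$ The set of all such $T$ is $\mathcal L^{m+}_{w,(q,r)}(E_1,\dots,E_m;F)$, and $d^{m+}_{w,(q,r)}(T)$ is the infimum of all such constants $C$. *)

(* Defs.v *)
From HB Require Import structures.
From mathcomp Require Import all_boot all_order all_algebra.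
From mathcomp Require Import all_classical all_reals all_analysis.
From mathcomp Require Import ring.

Set Implicit Arguments.
Unset Strict Implicit.
Unset Printing Implicit Defensive.

Import Order.TTheory GRing.Theory Num.Theory.
Import numFieldNormedType.Exports.

Local Open Scope classical_set_scope.
Local Open Scope ring_scope.

(* The lattice order is a field of its own and not an instance of
   Order.Lattice: Hierarchy Builder rejects a structure above both NormedModule
   and Order.POrder that is declared after Num.NumDomain. *)
HB.mixin Record isBanachLattice (R : realType) E of CompleteNormedModule R E := {
  vle : E -> E -> Prop;
  vjoin : E -> E -> E;
  vmeet : E -> E -> E;
  vle_refl : forall x, vle x x;
  vle_anti : forall x y, vle x y -> vle y x -> x = y;
  vle_trans : forall y x z, vle x y -> vle y z -> vle x z;
  vjoinP : forall x y z, vle (vjoin x y) z <-> vle x z /\ vle y z;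
  vmeetP : forall x y z, vle z (vmeet x y) <-> vle z x /\ vle z y;
  vle_add2r : forall z x y : E, vle x y -> vle (x + z) (y + z);
  vle_scale_ge0 : forall (a : R) (x : E), 0 <= a -> vle 0 x -> vle 0 (a *: x);
  vle_norm : forall x y : E,
    vle (vjoin x (- x)) (vjoin y (- y)) -> `|x| <= `|y|
}.

#[short(type="banachLatticeType")]
HB.structure Definition BanachLattice (R : realType) :=
  {E of CompleteNormedModule R E & isBanachLattice R E}.

Arguments vle_trans {R s y x z}.
Arguments vle_anti {R s x y}.
Arguments vle_add2r {R s} z {x y}.
Arguments vle_scale_ge0 {R s a x}.
Arguments vle_norm {R s x y}.

Notation "x <=L y" := (vle x y) (at level 70, no associativity) : ring_scope.

Definition vabs (R : realType) (E : banachLatticeType R) (x : E) : E :=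
  vjoin x (- x).

Definition positive_map (R : realType) (E F : banachLatticeType R)
  (u : E -> F) := forall x : E, 0 <=L x -> 0 <=L u x.

Definition opnorm (R : realType) (V W : normedModType R) (f : V -> W) : R :=
  sup [set `|f x| | x in [set x : V | `|x| <= 1]].

Section opnorm_theory.
Context {R : realType} {V W : normedModType R}.
Implicit Types f : {linear V -> W}.

Lemma opnorm_le (f : V -> W) M :
  (forall x, `|f x| <= M * `|x|) -> 0 <= M -> opnorm f <= M.
Proof.
move=> fM M0; apply: ge_sup.
  by exists `|f 0|; exists 0 => //=; rewrite normr0.
move=> _ [x /= x1 <-]; apply: le_trans (fM x) _.
by rewrite -[leRHS]mulr1 ler_wpM2l.
Qed.

Lemma linear_bound f : continuous f ->
  exists2 M, 0 <= M & forall x, `|f x| <= M * `|x|.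
Proof.
move=> /linear_bounded_continuous/linear_boundedP/pinfty_ex_gt0[M M0 fM].
by exists M => //; exact: ltW.
Qed.

Lemma opnorm_has_sup f : continuous f ->
  has_sup [set `|f x| | x in [set x : V | `|x| <= 1]].
Proof.
move=> /linear_bound[M M0 fM]; split.
  by exists `|f 0|; exists 0 => //=; rewrite normr0.
exists M => _ [x /= x1 <-]; apply: le_trans (fM x) _.
by rewrite -[leRHS]mulr1 ler_wpM2l.
Qed.

Lemma opnorm_ge0 f : continuous f -> 0 <= opnorm f.
Proof.
move=> cf; apply: le_trans (normr_ge0 (f 0)) _.
by apply: (sup_upper_bound (opnorm_has_sup cf)); exists 0 => //=; rewrite normr0.
Qed.

Lemma le_opnorm f x : continuous f -> `|f x| <= opnorm f * `|x|.
Proof.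
move=> cf; have [->|x0] := eqVneq x 0.
  by rewrite linear0 !normr0 mulr0.
have nx0 : 0 < `|x| by rewrite normr_gt0.
rewrite -ler_pdivrMr // mulrC.
have -> : `|x|^-1 * `|f x| = `|f (`|x|^-1 *: x)|.
  by rewrite linearZ normrZ gtr0_norm ?invr_gt0.
apply: (sup_upper_bound (opnorm_has_sup cf)); exists (`|x|^-1 *: x) => //=.
by rewrite normrZ gtr0_norm ?invr_gt0// mulVf ?gt_eqF.
Qed.

End opnorm_theory.

Section banach_lattice_theory.
Context {R : realType} {E : banachLatticeType R}.
Implicit Types x y z a b : E.

Lemma vle_joinl x y : x <=L vjoin x y.
Proof. by have [] := (vjoinP x y _).1 (vle_refl _). Qed.

Lemma vle_joinr x y : y <=L vjoin x y.
Proof. by have [] := (vjoinP x y _).1 (vle_refl _). Qed.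

Lemma vmeet_lel x y : vmeet x y <=L x.
Proof. by have [] := (vmeetP x y _).1 (vle_refl _). Qed.

Lemma vmeet_ler x y : vmeet x y <=L y.
Proof. by have [] := (vmeetP x y _).1 (vle_refl _). Qed.

Lemma vsub_ge0 x y : 0 <=L y - x <-> x <=L y.
Proof.
split=> [/(vle_add2r x)|/(vle_add2r (- x))]; first by rewrite subrK add0r.
by rewrite subrr.
Qed.

Lemma vadd_ge0 x y : 0 <=L x -> 0 <=L y -> 0 <=L x + y.
Proof.
by move=> x0 y0; apply: vle_trans y0 _; rewrite -{1}[y]add0r; exact: vle_add2r.
Qed.

Lemma vopp_le x y : x <=L y -> - y <=L - x.
Proof. by move=> /vsub_ge0 h; apply/vsub_ge0; rewrite opprK addrC. Qed.

Lemma vabs_ge0 x : 0 <=L vabs x.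
Proof.
have h : 0 <=L vabs x + vabs x.
  have := vadd_ge0 ((vsub_ge0 _ _).2 (vle_joinl x (- x)))
                   ((vsub_ge0 _ _).2 (vle_joinr x (- x))).
  by rewrite opprK addrACA [- x + x]addNr addr0.
have -> : vabs x = 2^-1 *: (vabs x + vabs x).
  by rewrite scalerDr -scalerDl -[2^-1]mul1r -splitr scale1r.
by apply: vle_scale_ge0 => //; rewrite invr_ge0.
Qed.

Lemma ge0_vabs x : 0 <=L x -> vabs x = x.
Proof.
move=> x0; apply: vle_anti; last exact: vle_joinl.
apply/vjoinP; split; first exact: vle_refl.
by apply: (vle_trans _ x0); rewrite -oppr0; exact: vopp_le.
Qed.

Lemma norm_vabs x : `|vabs x| = `|x|.
Proof.
apply/eqP; rewrite eq_le; apply/andP.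
by split; apply: vle_norm; rewrite -/(vabs _) -/(vabs _) (ge0_vabs (vabs_ge0 x));
   exact: vle_refl.
Qed.

Lemma vle_norm_abs x y : vabs x <=L y -> `|x| <= `|y|.
Proof.
move=> h; apply: vle_norm; apply: vle_trans h _; exact: vle_joinl.
Qed.

Lemma vle_norm0 x y : 0 <=L x -> x <=L y -> `|x| <= `|y|.
Proof. by move=> x0 xy; apply: vle_norm_abs; rewrite ge0_vabs. Qed.

Definition vpos x := vjoin x 0.
Definition vneg x := vpos x - x.

Lemma vpos_ge0 x : 0 <=L vpos x. Proof. exact: vle_joinr. Qed.
Lemma vneg_ge0 x : 0 <=L vneg x. Proof. by apply/vsub_ge0; exact: vle_joinl. Qed.
Lemma vpos_neg x : vpos x - vneg x = x.
Proof. by rewrite /vneg opprB addrC subrK. Qed.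

Lemma vpos_norm x : `|vpos x| <= `|x|.
Proof.
rewrite -(norm_vabs x); apply: vle_norm0; first exact: vpos_ge0.
by apply/vjoinP; split; [exact: vle_joinl|exact: vabs_ge0].
Qed.

Lemma vneg_norm x : `|vneg x| <= `|x|.
Proof.
rewrite -(norm_vabs x); apply: vle_norm0; first exact: vneg_ge0.
apply/vsub_ge0; rewrite opprB addrA; apply/vsub_ge0/vjoinP; split.
  have := vadd_ge0 (vabs_ge0 x) (vle_refl 0); rewrite addr0 => h.
  by apply/vsub_ge0; rewrite addrK.
apply/vsub_ge0; rewrite subr0 -[X in _ + X]opprK.
by apply/vsub_ge0; exact: vle_joinr.
Qed.

Lemma riesz_decomposition x y z : 0 <=L x -> 0 <=L y -> 0 <=L z ->
  z <=L x + y ->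
  exists a b, [/\ z = a + b, 0 <=L a, a <=L x, 0 <=L b & b <=L y].
Proof.
move=> x0 y0 z0 zxy; exists (vmeet z x), (z - vmeet z x); split.
- by rewrite addrC subrK.
- by apply/vmeetP.
- exact: vmeet_ler.
- by apply/vsub_ge0; exact: vmeet_lel.
- apply/vsub_ge0; rewrite opprB addrCA -(opprB z y).
  apply/vsub_ge0/vmeetP; split; apply/vsub_ge0.
    by rewrite opprB addrC subrK.
  by rewrite opprB addrA; apply/vsub_ge0.
Qed.

End banach_lattice_theory.

#[local] Hint Resolve vle_refl vpos_ge0 vneg_ge0 vabs_ge0 : core.

Section dual.
Context {R : realType} (E : banachLatticeType R).

Definition continuous_linear : {pred E -> R^o} :=
  mem [set f : E -> R^o | linear f /\ continuous f].

Record dual := Dual {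
  dual_fun :> E -> R^o;
  dual_funP : dual_fun \in continuous_linear
}.

HB.instance Definition _ := [isSub for dual_fun].
HB.instance Definition _ := [Choice of dual by <:].

Lemma continuous_linear_submod : submod_closed continuous_linear.
Proof.
split=> [|a f g]; rewrite !inE /=.
  split=> [k x y|x]; last exact: cst_continuous.
  by rewrite /= scaler0 addr0.
move=> [lf cf] [lg cg]; split=> [k x y|x].
  change (a *: f (k *: x + y) + g (k *: x + y) =
          k *: (a *: f x + g x) + (a *: f y + g y)).
  by rewrite lf lg !scalerDr !scalerA [a * k]mulrC addrACA.
apply: cvgD; last exact: cg.
by apply: cvgZl_tmp; exact: cf.
Qed.
HB.instance Definition _ :=
  GRing.isSubmodClosed.Build R (E -> R^o) continuous_linear continuous_linear_submod.
HB.instance Definition _ := [SubChoice_isSubLmodule of dual by <:].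


Implicit Types (f g h : dual) (x y z : E).

Lemma dual_linear f : linear f.
Proof. by have := dual_funP f; rewrite inE => -[]. Qed.
HB.instance Definition _ f :=
  GRing.isLinear.Build R E R^o *:%R f (dual_linear f).

Lemma dual_continuous f : continuous f.
Proof. by have := dual_funP f; rewrite inE => -[]. Qed.

Lemma dualP f g : (forall x, f x = g x) -> f = g.
Proof. by move=> fg; apply: val_inj; apply/funext. Qed.

Lemma dualDE f g x : (f + g) x = f x + g x. Proof. by []. Qed.
Lemma dualNE f x : (- f) x = - f x. Proof. by []. Qed.
Lemma dualZE a f x : (a *: f) x = a * f x. Proof. by []. Qed.

Lemma bounded_continuous_linear (f : E -> R^o) M : linear f ->
  (forall x, `|f x| <= M * `|x|) -> f \in continuous_linear.
Proof.
move=> lf fM; rewrite inE; split=> //.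
pose g : {linear E -> R^o} := HB.pack f (GRing.isLinear.Build _ _ _ _ f lf).
apply: (@bounded_linear_continuous _ _ _ g); apply/linear_boundedP.
near=> r => x; apply: le_trans (fM x) _.
apply: ler_wpM2r; first exact: normr_ge0.
by near: r; apply: nbhs_pinfty_ge; exact: num_real.
Unshelve. all: by end_near. Qed.

Lemma dual_le_opnorm f x : `|f x| <= opnorm f * `|x|.
Proof. apply: (@le_opnorm _ _ _ f); exact: dual_continuous. Qed.

Lemma dual_opnorm_ge0 f : 0 <= opnorm f.
Proof. apply: (@opnorm_ge0 _ _ _ f); exact: dual_continuous. Qed.

Lemma dual_normD f g : opnorm (f + g) <= opnorm f + opnorm g.
Proof.
apply: opnorm_le; last by rewrite addr_ge0 ?dual_opnorm_ge0.
move=> x; rewrite dualDE mulrDl.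
by apply: le_trans (ler_normD _ _) _; rewrite lerD ?dual_le_opnorm.
Qed.

Lemma dual_normZ (l : R) f : opnorm (l *: f) = `|l| * opnorm f.
Proof.
have le k h : opnorm (k *: h) <= `|k| * opnorm h.
  apply: opnorm_le; last by rewrite mulr_ge0 ?dual_opnorm_ge0.
  by move=> x; rewrite dualZE normrM -mulrA ler_wpM2l ?dual_le_opnorm.
apply/eqP; rewrite eq_le le andTb.
have [->|l0] := eqVneq l 0; first by rewrite normr0 mul0r dual_opnorm_ge0.
rewrite mulrC -ler_pdivlMr ?normr_gt0// mulrC -normfV.
by apply: le_trans (le _ _); rewrite scalerA mulVf// scale1r.
Qed.

Lemma dual_norm0 f : opnorm f = 0 -> f = 0.
Proof.
move=> f0; apply: dualP => x; apply/eqP; rewrite -normr_le0.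
by apply: le_trans (dual_le_opnorm f x) _; rewrite f0 mul0r.
Qed.

HB.instance Definition _ := Lmodule_isNormed.Build R dual
  dual_normD dual_normZ dual_norm0.

Lemma dual_le_norm f x : `|f x| <= `|f| * `|x|.
Proof. exact: dual_le_opnorm. Qed.

Lemma dual_norm_le f M : 0 <= M -> (forall x, `|f x| <= M * `|x|) -> `|f| <= M.
Proof. by move=> M0 fM; exact: opnorm_le. Qed.

Lemma dual_complete (F : set_system dual) :
  ProperFilter F -> cauchy F -> cvg F.
Proof.
move=> FF /cauchyP Fc.
have Fe (e : R) : 0 < e -> exists f, F [set g | `|f - g| < e].
  by move=> /Fc[f Ff]; exists f; move: Ff; rewrite -ball_normE.
have cx x : cvg ((fun f => f x) @ F).
  apply: cauchy_cvg; apply/cauchyP => e e0.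
  have x1 : 0 < `|x| + 1 by rewrite ltr_wpDl.
  have [f Ff] := Fe _ (divr_gt0 e0 x1).
  exists (f x); rewrite -ball_normE.
  change (F [set g | `|f x - g x| < e]); apply: filterS Ff => g /= fg.
  have := dual_le_norm (f - g) x; rewrite dualDE dualNE => /le_lt_trans; apply.
  apply: (@le_lt_trans _ _ (e / (`|x| + 1) * `|x|)).
    by rewrite ler_wpM2r// ltW.
  by rewrite mulrAC ltr_pdivrMr// ltr_pM2l// ltrDl.
pose L x : R^o := lim ((fun f => f x) @ F).
have Le (e : R) : 0 < e -> exists f, F [set g | `|f - g| < e] /\
    forall x, `|f x - L x| <= e * `|x|.
  move=> e0; have [f Ff] := Fe _ e0; exists f; split=> // x.
  have cL : (fun g => `|f x - g x|) @ F --> `|f x - L x|.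
    by apply: cvg_norm; apply: cvgB; [exact: cvg_cst|exact: cx].
  apply: (closed_cvg (fun t : R => t <= e * `|x|) _ _ _ cL).
    exact: closed_le.
  apply: filterS Ff => g /= fg; have := dual_le_norm (f - g) x.
  by rewrite dualDE dualNE => /le_trans; apply; rewrite ler_wpM2r// ltW.
have lL : linear L.
  move=> a x y; apply/eqP; rewrite -subr_eq0 -normr_le0; apply/ler_addgt0Pl => e e0.
  rewrite addr0.
  pose K := `|a *: x + y| + (`|a| * `|x| + `|y|).
  have K0 : 0 <= K by rewrite !addr_ge0// mulr_ge0.
  have K1 : 0 < K + 1 by rewrite ltr_wpDl.
  have [f [_ fL]] := Le _ (divr_gt0 e0 K1).
  have -> : L (a *: x + y) - (a *: L x + L y) =
     - (f (a *: x + y) - L (a *: x + y)) + (a *: (f x - L x) + (f y - L y)).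
    have aux (k l fx lx fy ly : R) : l - (k * lx + ly) =
        - (k * fx + fy - l) + (k * (fx - lx) + (fy - ly)) by ring.
    by rewrite (dual_linear f); exact: aux.
  apply: (@le_trans _ _ (e / (K + 1) * K)).
    rewrite (mulrDr _ `|a *: x + y|).
    apply: le_trans (ler_normD _ _) _; rewrite normrN lerD ?fL// mulrDr.
    apply: le_trans (ler_normD _ _) _; rewrite lerD ?fL// normrM mulrCA.
    by rewrite ler_wpM2l ?fL.
  by rewrite mulrAC ler_pdivrMr// ler_pM2l// lerDl.
have [f1 [_ f1L]] := Le _ ltr01.
have LM x : `|L x| <= (1 + `|f1|) * `|x|.
  rewrite -[L x](subKr (f1 x)); apply: le_trans (ler_normB _ _) _.
  by rewrite addrC mulrDl lerD ?dual_le_norm.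
pose l := Dual (bounded_continuous_linear lL LM).
apply/cvg_ex; exists l; apply/cvgrPdist_le => e e0.
have e20 : 0 < e / 2 by rewrite divr_gt0.
have [f [Ff fL]] := Le _ e20.
apply: filterS Ff => g /= fg; rewrite (splitr e).
rewrite -(subrK f l) -addrA; apply: le_trans (ler_normD _ _) _.
rewrite lerD ?(ltW fg)//.
apply: dual_norm_le; first exact: ltW.
by move=> x; rewrite dualDE dualNE distrC; exact: fL.
Qed.

HB.instance Definition _ := Uniform_isComplete.Build dual dual_complete.

(* Riesz--Kantorovich: the positive part of f maps x >= 0 to
   sup {f z | 0 <= z <= x}. *)
Definition cone_pos f x : R :=
  sup [set (f z : R) | z in [set z | 0 <=L z /\ z <=L x]].

Section cone_pos_theory.
Variable f : dual.

Lemma cone_pos_bound x z : 0 <=L z -> z <=L x -> f z <= `|f| * `|x|.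
Proof.
move=> z0 zx; apply: le_trans (ler_norm _) _.
apply: le_trans (dual_le_norm f z) _.
by rewrite ler_wpM2l// vle_norm0.
Qed.

Lemma cone_pos_has_sup x : 0 <=L x ->
  has_sup [set (f z : R) | z in [set z | 0 <=L z /\ z <=L x]].
Proof.
move=> x0; split; first by exists (f 0), 0 => //=; split=> //; exact: vle_refl.
by exists (`|f| * `|x|) => _ [z [z0 zx] <-]; exact: cone_pos_bound.
Qed.

Lemma le_cone_pos x z : 0 <=L z -> z <=L x -> f z <= cone_pos f x.
Proof.
move=> z0 zx; apply: (sup_upper_bound (cone_pos_has_sup (vle_trans z0 zx))).
by exists z.
Qed.

Lemma cone_pos_le x M : 0 <=L x ->
  (forall z, 0 <=L z -> z <=L x -> f z <= M) -> cone_pos f x <= M.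
Proof.
move=> x0 h; apply: ge_sup; first by case: (cone_pos_has_sup x0).
by move=> _ [z [z0 zx] <-]; exact: h.
Qed.

Lemma cone_pos_ge0 x : 0 <=L x -> 0 <= cone_pos f x.
Proof.
by move=> x0; have := le_cone_pos (vle_refl 0) x0; rewrite linear0.
Qed.

Lemma cone_pos0 : cone_pos f 0 = 0.
Proof.
apply/eqP; rewrite eq_le cone_pos_ge0 ?andbT; last exact: vle_refl.
apply: cone_pos_le; first exact: vle_refl.
by move=> z z0 /vle_anti -> //; rewrite linear0.
Qed.

Lemma cone_posD x y : 0 <=L x -> 0 <=L y ->
  cone_pos f (x + y) = cone_pos f x + cone_pos f y.
Proof.
move=> x0 y0; apply/eqP; rewrite eq_le; apply/andP; split.
  apply: cone_pos_le; first exact: vadd_ge0.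
  move=> z z0 zxy.
  have [a [b [-> a0 ax b0 yb]]] := riesz_decomposition x0 y0 z0 zxy.
  by rewrite linearD lerD// le_cone_pos.
rewrite -lerBrDr; apply: cone_pos_le => // a a0 ax.
rewrite lerBrDl -lerBrDr; apply: cone_pos_le => // b b0 bx.
rewrite lerBrDr -[leLHS](linearD f); apply: le_cone_pos; first exact: vadd_ge0.
apply: (vle_trans (vle_add2r a bx)).
by rewrite addrC; exact: vle_add2r.
Qed.

Lemma cone_posZ a x : 0 <= a -> 0 <=L x ->
  cone_pos f (a *: x) = a * cone_pos f x.
Proof.
have le b y : 0 < b -> 0 <=L y -> cone_pos f (b *: y) <= b * cone_pos f y.
  move=> b0 y0; apply: cone_pos_le; first exact: vle_scale_ge0 (ltW b0) y0.
  move=> z z0 zy; rewrite -ler_pdivrMl//.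
  have -> : b^-1 * f z = f (b^-1 *: z) by rewrite linearZ.
  have bi : 0 <= b^-1 by rewrite invr_ge0 ltW.
  apply: le_cone_pos; first exact: vle_scale_ge0.
  apply/vsub_ge0.
  rewrite -[y](scalerK (lt0r_neq0 b0)) -scalerBr.
  by apply: vle_scale_ge0 => //; exact/vsub_ge0.
rewrite le_eqVlt => /predU1P[<- _|a0 x0].
  by rewrite scale0r cone_pos0 mul0r.
apply/eqP; rewrite eq_le le//=.
rewrite -ler_pdivlMl//; apply: le_trans (le _ _ _ _).
- by rewrite scalerK// gt_eqF.
- by rewrite invr_gt0.
- exact: vle_scale_ge0 (ltW a0) x0.
Qed.

Definition dual_pos_fun x : R^o := cone_pos f (vpos x) - cone_pos f (vneg x).

Lemma dual_pos_funE x a b : 0 <=L a -> 0 <=L b -> x = a - b ->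
  dual_pos_fun x = cone_pos f a - cone_pos f b.
Proof.
move=> a0 b0 xab; apply/eqP; rewrite /dual_pos_fun subr_eq addrAC eq_sym subr_eq.
rewrite -!cone_posD//; apply/eqP; congr cone_pos.
by apply/eqP; rewrite -subr_eq addrAC -xab eq_sym -subr_eq vpos_neg.
Qed.

Lemma dual_pos_fun_linear : linear dual_pos_fun.
Proof.
move=> k x y.
have [k0|k0] := leP 0 k.
  rewrite (@dual_pos_funE _ (k *: vpos x + vpos y) (k *: vneg x + vneg y)).
  - rewrite (cone_posD (x := _ *: vpos x))// ?(cone_posD (x := _ *: vneg x))//;
      try exact: vle_scale_ge0.
    by rewrite !cone_posZ// /dual_pos_fun scalerBr opprD addrACA.
  - by apply: vadd_ge0 (vpos_ge0 y); exact: vle_scale_ge0 k0 (vpos_ge0 x).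
  - by apply: vadd_ge0 (vneg_ge0 y); exact: vle_scale_ge0 k0 (vneg_ge0 x).
  - by rewrite opprD addrACA -scalerBr !vpos_neg.
have nk : 0 <= - k by rewrite oppr_ge0 ltW.
rewrite (@dual_pos_funE _ (- k *: vneg x + vpos y) (- k *: vpos x + vneg y)).
- rewrite (cone_posD (x := _ *: vneg x))// ?(cone_posD (x := _ *: vpos x))//;
    try exact: vle_scale_ge0.
  rewrite !cone_posZ// /dual_pos_fun scalerBr opprD addrACA !mulNr opprK.
  by congr (_ + _); rewrite addrC.
- by apply: vadd_ge0 (vpos_ge0 y); exact: vle_scale_ge0 nk (vneg_ge0 x).
- by apply: vadd_ge0 (vneg_ge0 y); exact: vle_scale_ge0 nk (vpos_ge0 x).
- by rewrite opprD addrACA -scalerBr scaleNr -scalerN opprB !vpos_neg.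
Qed.

Lemma dual_pos_fun_bound x : `|dual_pos_fun x| <= (`|f| + `|f|) * `|x|.
Proof.
have cp y : 0 <=L y -> `|y| <= `|x| -> `|cone_pos f y| <= `|f| * `|x|.
  move=> y0 yx; rewrite ger0_norm ?cone_pos_ge0//.
  apply: cone_pos_le => // z z0 zy.
  by apply: le_trans (cone_pos_bound z0 zy) _; rewrite ler_wpM2l.
apply: le_trans (ler_normB _ _) _; rewrite mulrDl.
by rewrite lerD// cp ?vpos_norm ?vneg_norm.
Qed.

Definition dual_pos : dual :=
  Dual (bounded_continuous_linear dual_pos_fun_linear dual_pos_fun_bound).

Lemma dual_posE x : 0 <=L x -> dual_pos x = cone_pos f x.
Proof.
move=> x0; rewrite /= (@dual_pos_funE _ x 0)//; last by rewrite subr0.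
by rewrite cone_pos0 subr0.
Qed.

End cone_pos_theory.

Definition dual_le f g := forall x, 0 <=L x -> (f x : R) <= g x.
Definition dual_join f g : dual := g + dual_pos (f - g).
Definition dual_meet f g : dual := - dual_join (- f) (- g).

Lemma dual_le_refl f : dual_le f f. Proof. by move=> x. Qed.

Lemma dual_le_anti f g : dual_le f g -> dual_le g f -> f = g.
Proof.
move=> fg gf; apply: dualP => x.
have hE h : h x = h (vpos x) - h (vneg x) by rewrite -linearB vpos_neg.
by rewrite !hE; congr (_ - _); apply/eqP; rewrite eq_le fg ?gf.
Qed.

Lemma dual_le_trans g f h : dual_le f g -> dual_le g h -> dual_le f h.
Proof. by move=> fg gh x x0; apply: le_trans (fg x x0) (gh x x0). Qed.

Lemma dual_joinP f g h : dual_le (dual_join f g) h <-> dual_le f h /\ dual_le g h.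
Proof.
split=> [fgh|[fh gh] x x0].
  split=> x x0; have := fgh x x0; rewrite dualDE dual_posE// => /(le_trans _); apply.
    have := le_cone_pos (f - g) x0 (vle_refl x).
    by rewrite dualDE dualNE lerBlDl.
  by rewrite lerDl cone_pos_ge0.
rewrite dualDE dual_posE// -lerBrDl; apply: cone_pos_le => // z z0 zx.
rewrite dualDE dualNE.
have := fh z z0; have := gh _ ((vsub_ge0 _ _).2 zx); rewrite !linearB /= => h1 h2.
rewrite lerBrDl addrCA; apply: le_trans (lerD h2 h1) _.
by rewrite addrC subrK.
Qed.

Lemma dual_meetP f g h : dual_le h (dual_meet f g) <-> dual_le h f /\ dual_le h g.
Proof.
have leN f1 f2 : dual_le f1 (- f2) <-> dual_le f2 (- f1).
  by split=> fg x x0; have := fg x x0; rewrite !dualNE lerNr.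
rewrite leN dual_joinP; split=> -[h1 h2].
  by split; rewrite -[X in dual_le _ X]opprK leN.
by split; rewrite leN opprK.
Qed.

Lemma dual_le_add2r h f g : dual_le f g -> dual_le (f + h) (g + h).
Proof. by move=> fg x x0; rewrite !dualDE lerD2r fg. Qed.

Lemma dual_le_scale_ge0 (a : R) f : 0 <= a -> dual_le 0 f -> dual_le 0 (a *: f).
Proof. by move=> a0 f0 x x0; rewrite dualZE mulr_ge0//; exact: f0. Qed.

Lemma dual_abs_le f x : `|f x| <= dual_join f (- f) (vabs x).
Proof.
have [h1 h2] := (dual_joinP f (- f) _).1 (dual_le_refl _).
have ab y : y <=L vabs x -> - y <=L vabs x -> f y <= dual_join f (- f) (vabs x).
  move=> yx nyx.
  pose a := vabs x + y; pose b := vabs x - y.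
  have a0 : 0 <=L a by rewrite /a -[y]opprK; apply/vsub_ge0.
  have b0 : 0 <=L b by apply/vsub_ge0.
  have eab : a - b = y + y by rewrite /a /b opprB addrC addrA subrK.
  have sab : a + b = vabs x + vabs x by rewrite /a /b addrACA subrr addr0.
  have := lerD (h1 a a0) (h2 b b0).
  have -> : f a + (- f) b = f y + f y by rewrite dualNE -linearB -linearD eab.
  by rewrite -[leRHS]linearD sab [leRHS]linearD -!mulr2n lerMn2r.
rewrite ler_norml lerNl -linearN /=.
by rewrite !ab ?opprK//; first [exact: vle_joinl|exact: vle_joinr].
Qed.

Lemma dual_join_norm f x : 0 <=L x -> dual_join f (- f) x <= `|f| * `|x|.
Proof.
move=> x0; rewrite dualDE dual_posE// -lerBrDl; apply: cone_pos_le => // z z0 zx.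
rewrite opprK dualDE !dualNE opprK -lerBlDr -linearD -linearB /=.
apply: le_trans (ler_norm _) _; apply: le_trans (dual_le_norm f _) _.
rewrite ler_wpM2l//; apply: vle_norm_abs; apply/vjoinP; split.
  apply/vsub_ge0; rewrite opprB addrA opprD addrACA.
  by apply: vadd_ge0; apply/vsub_ge0.
by apply/vsub_ge0; rewrite opprK addrC subrK; exact: vadd_ge0.
Qed.

Lemma dual_le_normP f g :
  dual_le (dual_join f (- f)) (dual_join g (- g)) -> `|f| <= `|g|.
Proof.
move=> fg; apply: dual_norm_le => // x.
apply: le_trans (dual_abs_le f x) _.
apply: le_trans (fg _ (vabs_ge0 x)) _.
by rewrite -(norm_vabs x); apply: dual_join_norm; exact: vabs_ge0.
Qed.

HB.instance Definition _ := isBanachLattice.Build R dual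
  dual_le_refl dual_le_anti dual_le_trans dual_joinP dual_meetP
  dual_le_add2r dual_le_scale_ge0 dual_le_normP.

End dual.

(* The second branch is meant for p = +oo only; every exponent is >= 1. *)
Definition lpnorm (R : realType) (p : \bar R) (n : nat) (a : 'I_n -> R) : R :=
  if p is s%:E then (\sum_(i < n) `|a i| `^ s) `^ s^-1
  else \big[Num.max/0]_(i < n) `|a i|.

Definition wnorm (R : realType) (G : banachLatticeType R) (r : \bar R) (n : nat)
    (y : 'I_n -> G) : R :=
  sup [set lpnorm r (fun i => xi (vabs (y i)) : R)
      | xi in [set xi : dual G | 0 <=L xi /\ `|xi| <= 1]].

Section multilinear.
Context {R : realType} {m : nat} (E : 'I_m -> banachLatticeType R).

Definition multilinear (W : normedModType R) (T : (forall j, E j) -> W) :=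
  forall (j : 'I_m) (x : forall j, E j), linear (fun y : E j => T (dfwith x j y)).

Definition multibounded (W : normedModType R) (T : (forall j, E j) -> W) :=
  exists M : R, forall x, `|T x| <= M * \prod_(j < m) `|x j|.

Definition multinorm (W : normedModType R) (T : (forall j, E j) -> W) : R :=
  sup [set `|T x| | x in [set x : forall j, E j | forall j, `|x j| <= 1]].

(* multibounded is required because multinorm, a real supremum, is 0 on an
   unbounded form. *)
Definition positive_forms_ball : set ((forall j, E j) -> R^o) :=
  [set phi | [/\ multilinear phi, multibounded phi,
    forall x, (forall j, 0 <=L x j) -> 0 <= (phi x : R) & multinorm phi <= 1]].

Context (F : banachLatticeType R).

Definition domination_const (p q r : \bar R) (T : (forall j, E j) -> F) (C : R) :=
  forall (n : nat) (x : 'I_n -> forall j, E j) (y : 'I_n -> dual F),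
    (forall i j, 0 <=L x i j) -> (forall i, 0 <=L y i) ->
    lpnorm p (fun i => y i (T (x i)) : R) <=
      C * sup [set lpnorm q (fun i => phi (x i) : R)
              | phi in positive_forms_ball] * wnorm r y.

Definition pos_weakly_dominated (p q r : \bar R) (T : (forall j, E j) -> F) :=
  [/\ multilinear T, multibounded T &
      exists2 C : R, 0 < C & domination_const p q r T C].

Definition pos_weakly_dominated_norm (p q r : \bar R)
    (T : (forall j, E j) -> F) : R :=
  inf [set C : R | 0 < C /\ domination_const p q r T C].

End multilinear.

(* Main.v *)
(** If [C] is a domination constant of [T], then [C * \prod_j |u j| * |v|] is one
    of [v \o T \o u], because composition does not leave the test objects: for a
    positive form [phi] of norm at most 1 the form [phi \o u] is
    [\prod_j |u j|] times a form of the same kind, and for a positive [xi] in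
    the unit ball of [F^**] the functional [xi \o v^*] is [|v|] times one in the
    unit ball of [H^**].  Taking the infimum over [C] gives the bound. *)
Require Import Defs.
From HB Require Import structures.
From mathcomp Require Import all_boot all_order all_algebra.
From mathcomp Require Import all_classical all_reals all_analysis.

Set Implicit Arguments.
Unset Strict Implicit.
Unset Printing Implicit Defensive.

Import Order.TTheory GRing.Theory Num.Theory.
Import numFieldNormedType.Exports.

Local Open Scope classical_set_scope.
Local Open Scope ring_scope.

(** * Finite power norms, suprema of nonnegative reals, and scaling *)

Lemma lpnorm_ge0 (R : realType) (p : \bar R) n (a : 'I_n -> R) :
  0 <= lpnorm p a.
Proof. by case: p => [s| |] /=; rewrite ?powR_ge0 ?bigmax_ge_id. Qed.

Lemma lpnorm_mono (R : realType) (p : \bar R) n (a b : 'I_n -> R) :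
  (1 <= p)%E -> (forall i, `|a i| <= `|b i|) -> lpnorm p a <= lpnorm p b.
Proof.
case: p => [s| |] //= s1 ab; last by apply: le_bigmax2.
have s0 : 0 <= s by rewrite lee_fin in s1; exact: le_trans ler01 s1.
apply: ge0_ler_powR; rewrite ?invr_ge0// ?nnegrE.
- by apply: sumr_ge0 => i _; exact: powR_ge0.
- by apply: sumr_ge0 => i _; exact: powR_ge0.
- by apply: ler_sum => i _; apply: ge0_ler_powR; rewrite ?nnegrE.
Qed.

Lemma lpnormZ (R : realType) (p : \bar R) n (c : R) (a : 'I_n -> R) :
  (1 <= p)%E -> 0 <= c -> lpnorm p (fun i => c * a i) = c * lpnorm p a.
Proof.
case: p => [s| |] //= s1 c0; last first.
  elim/big_rec2: _ => [|i x y _ ->]; first by rewrite mulr0.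
  by rewrite normrM ger0_norm// maxr_pMr.
have s0 : s != 0 by rewrite gt_eqF//; rewrite lee_fin in s1; exact: lt_le_trans s1.
under eq_bigr do rewrite normrM powRM// ger0_norm//.
rewrite -mulr_sumr powRM ?powR_ge0//; last first.
  by apply: sumr_ge0 => i _; exact: powR_ge0.
by rewrite -powRrM mulfV// powRr1.
Qed.

(** Boundedness need not be checked: [sup] takes the default value 0 on a set without a supremum. *)
Lemma sup_ge0 (R : realType) (A : set R) :
  (forall a, A a -> 0 <= a) -> 0 <= sup A.
Proof.
move=> A0; have [hA|/sup_out->//] := pselect (has_sup A).
have [[a Aa] _] := hA.
exact: le_trans (A0 _ Aa) (sup_upper_bound hA Aa).
Qed.

Lemma linear_scale (R : realType) (V W : lmodType R) (f : V -> W) a x :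
  linear f -> f (a *: x) = a *: f x.
Proof.
move=> lf; have f0 : f 0 = 0.
  by have := lf (-1) 0 0; rewrite scaler0 addr0 scaleN1r addNr.
by have := lf a x 0; rewrite f0 !addr0.
Qed.

(** * Homogeneity and the norm of bounded multilinear maps *)

Section multilinear_theory.
Context {R : realType} {m : nat} (E : 'I_m -> banachLatticeType R).
Context (W : normedModType R).
Implicit Types (T : (forall j, E j) -> W) (x : forall j, E j).

(** Induction on the list [s] of coordinates that are scaled: each new coordinate costs one use of
    linearity in that variable. *)
Lemma multilinearZ T (c : 'I_m -> R) x : multilinear T ->
  T (fun j => c j *: x j) = (\prod_j c j) *: T x.
Proof.
move=> lT.
have H (s : seq 'I_m) : uniq s ->
    T (fun j => if j \in s then c j *: x j else x j) = (\prod_(j <- s) c j) *: T x.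
  elim: s => [_|i s IH /= /andP[ni us]]; first by rewrite big_nil scale1r.
  rewrite big_cons -scalerA -IH//.
  set g := fun j => if j \in s then _ else _.
  (* Since [i] is not in [s], writing [x i] at [i] changes nothing; this puts [g] in the form to
     which linearity in variable [i] applies. *)
  have gi : dfwith g i (x i) = g.
    apply: functional_extensionality_dep => j.
    by case: dfwithP => //; rewrite /g (negbTE ni).
  rewrite -[in RHS]gi -(linear_scale _ _ (lT i g)); congr T.
  apply: functional_extensionality_dep => j; rewrite in_cons.
  case: dfwithP => [|k ik]; first by rewrite eqxx.
  by rewrite eq_sym (negbTE ik).
rewrite -(H _ (index_enum_uniq _)); congr T.
by apply: functional_extensionality_dep => j; rewrite mem_index_enum.
Qed.

Lemma multiboundedP T : multibounded T ->
  exists2 M : R, 0 <= M & forall x, `|T x| <= M * \prod_j `|x j|.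
Proof.
move=> [M TM]; exists `|M| => // x; apply: le_trans (TM x) _.
by apply: ler_wpM2r; [exact: prodr_ge0|exact: ler_norm].
Qed.

Lemma multinorm_ubound T M : 0 <= M ->
  (forall x, `|T x| <= M * \prod_j `|x j|) ->
  ubound [set `|T x| | x in [set x | forall j, `|x j| <= 1]] M.
Proof.
move=> M0 TM _ [y /= y1 <-]; apply: le_trans (TM y) _.
rewrite -[leRHS]mulr1; apply: ler_wpM2l => //.
by apply: prodr_ile1 => j _; rewrite normr_ge0 y1.
Qed.

(** Normalise every coordinate and pull the norms out by [multilinearZ]; the normalised tuple
    competes in the supremum. *)
Lemma le_multinorm T x : multilinear T -> multibounded T ->
  `|T x| <= multinorm T * \prod_j `|x j|.
Proof.
move=> lT /multiboundedP[M M0 TM].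
(* A zero coordinate cannot be normalised, but there the bound with [M] already gives [T x = 0]. *)
have [[j xj0]|x0] := pselect (exists j, x j = 0).
  have p0 : \prod_j `|x j| = 0 by rewrite (bigD1 j)//= xj0 normr0 mul0r.
  by apply: le_trans (TM x) _; rewrite p0 !mulr0.
have nx j : x j != 0 by apply/eqP => xj; apply: x0; exists j.
have xK j : `|x j| *: (`|x j|^-1 *: x j) = x j.
  by rewrite scalerA mulfV ?scale1r// normr_eq0 nx.
have {1}<- : (fun j => `|x j| *: (`|x j|^-1 *: x j)) = x.
  exact: functional_extensionality_dep.
rewrite multilinearZ// normrZ ger0_norm ?prodr_ge0// mulrC.
apply: ler_wpM2r; first exact: prodr_ge0.
apply: sup_upper_bound; last first.
  exists (fun j => `|x j|^-1 *: x j) => //= j.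
  by rewrite normrZ normfV normr_id mulVf// normr_eq0 nx.
split; first by exists `|T (fun=> 0)|, (fun=> 0) => //= j; rewrite normr0.
by exists M; exact: multinorm_ubound.
Qed.

Lemma multinorm_le T M : 0 <= M ->
  (forall x, `|T x| <= M * \prod_j `|x j|) -> multinorm T <= M.
Proof.
move=> M0 TM; apply: ge_sup.
  by exists `|T (fun=> 0)|, (fun=> 0) => //= j; rewrite normr0.
exact: multinorm_ubound.
Qed.

End multilinear_theory.

(** * Composition with a linear map in each variable *)

Section precomposition.
Context {R : realType} {m : nat} (E G : 'I_m -> banachLatticeType R).
Context (W : normedModType R) (T : (forall j, E j) -> W).
Context (u : forall j, {linear G j -> E j}).

Lemma multilinear_precomp : multilinear T ->
  multilinear (fun x : forall j, G j => T (fun j => u j (x j))).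
Proof.
move=> lT j x a y z.
have uE w : (fun k => u k (dfwith x j w k)) = dfwith (fun k => u k (x k)) j (u j w).
  apply: functional_extensionality_dep => k.
  by case: dfwithP => [|l jl]; rewrite ?dfwithin// dfwithout.
by rewrite !uE linearP; exact: lT.
Qed.

(** The constant [M] is left free so that the bound serves both [T] itself and forms of the unit
    ball, where [M] is 1. *)
Lemma le_precomp M : 0 <= M -> (forall j, continuous (u j)) ->
  (forall x, `|T x| <= M * \prod_j `|x j|) ->
  forall x, `|T (fun j => u j (x j))| <=
    M * \prod_j opnorm (u j) * \prod_j `|x j|.
Proof.
move=> M0 cu TM x; apply: le_trans (TM _) _.
rewrite -mulrA; apply: ler_wpM2l => //.
rewrite -big_split /=; apply: ler_prod => j _.
by rewrite normr_ge0 /=; exact: le_opnorm (cu j).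
Qed.

End precomposition.

(** * The unit ball of positive forms and its behaviour under precomposition *)

Lemma positive_forms_ball_norm (R : realType) m (E : 'I_m -> banachLatticeType R)
    (phi : (forall j, E j) -> R^o) x :
  positive_forms_ball phi -> `|phi x| <= \prod_j `|x j|.
Proof.
move=> [lphi bphi _ n1]; apply: le_trans (le_multinorm _ lphi bphi) _.
by rewrite -[leRHS]mul1r ler_wpM2r// prodr_ge0.
Qed.

(** The zero form gives nonemptiness, and [\prod_j |x i j|] bounds [phi (x i)] uniformly in
    [phi]. *)
Lemma positive_forms_ball_has_sup (R : realType) m
    (E : 'I_m -> banachLatticeType R) (q : \bar R) n (x : 'I_n -> forall j, E j) :
  (1 <= q)%E ->
  has_sup [set lpnorm q (fun i => phi (x i) : R)
          | phi in positive_forms_ball (E := E)].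
Proof.
move=> q1; split.
  exists (lpnorm q (fun i : 'I_n => 0 : R)), (fun=> 0) => //; split=> //.
  - by move=> j y a z w; rewrite scaler0 addr0.
  - by exists 0 => y; rewrite normr0 mul0r.
  - by apply: multinorm_le => // y; rewrite normr0 mul1r prodr_ge0.
exists (lpnorm q (fun i => \prod_j `|x i j|)) => _ [phi bphi <-].
apply: lpnorm_mono => // i; rewrite (ger0_norm (prodr_ge0 _ _))//.
exact: positive_forms_ball_norm.
Qed.

(* The factor [(\prod_j opnorm (u j))^-1] is [0] when the product is [0]; then
   [phi \o u] vanishes as well, so no case distinction is needed. *)
Lemma sup_forms_precomp (R : realType) m (E G : 'I_m -> banachLatticeType R)
    (u : forall j, {linear G j -> E j}) (q : \bar R) n
    (x : 'I_n -> forall j, G j) :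
  (1 <= q)%E -> (forall j, continuous (u j)) -> (forall j, positive_map (u j)) ->
  sup [set lpnorm q (fun i => phi (fun j => u j (x i j)) : R)
      | phi in positive_forms_ball (E := E)] <=
  \prod_j opnorm (u j) *
  sup [set lpnorm q (fun i => phi (x i) : R)
      | phi in positive_forms_ball (E := G)].
Proof.
move=> q1 cu pu; set N := \prod_j opnorm (u j).
have N0 : 0 <= N by apply: prodr_ge0 => j _; exact: opnorm_ge0 (cu j).
apply: ge_sup.
  by case: (positive_forms_ball_has_sup (fun i j => u j (x i j)) q1).
move=> _ [phi bphi <-].
pose phiu (y : forall j, G j) : R^o := phi (fun j => u j (y j)).
have phiuN y : `|phiu y| <= N * \prod_j `|y j|.
  rewrite -[N]mul1r; apply: le_precomp => // z.
  by rewrite mul1r; exact: positive_forms_ball_norm.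
pose psi (y : forall j, G j) : R^o := N^-1 * phiu y.
have phiuE y : phiu y = N * psi y.
  have [N00|N00] := eqVneq N 0; last by rewrite mulVKf.
  by apply/eqP; rewrite N00 mul0r -normr_le0; have := phiuN y; rewrite N00 mul0r.
(* The factor 1 is the constant that [multinorm_le] and [multibounded] ask for. *)
have psi1 y : `|psi y| <= 1 * \prod_j `|y j|.
  rewrite normrM ger0_norm ?invr_ge0//.
  apply: le_trans (ler_wpM2l _ (phiuN y)) _; first by rewrite invr_ge0.
  rewrite mulrA ler_wpM2r ?prodr_ge0//.
  by have [->|N00] := eqVneq N 0; rewrite ?mulr0// mulVf.
have bpsi : positive_forms_ball psi.
  have [lphi _ pphi _] := bphi; split.
  - move=> j y a z w; rewrite /psi.
    rewrite [phiu _](multilinear_precomp u lphi y a z w).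
    by rewrite mulrDr mulrCA.
  - by exists 1.
  - move=> y y0; rewrite mulr_ge0 ?invr_ge0// pphi// => j.
    exact: pu.
  - exact: multinorm_le.
have -> : (fun i => phi (fun j => u j (x i j)) : R) = (fun i => N * psi (x i)).
  by apply/funext => i; rewrite -phiuE.
rewrite lpnormZ//; apply: ler_wpM2l => //.
by apply: (sup_upper_bound (positive_forms_ball_has_sup x q1)); exists psi.
Qed.

(** * The adjoint of a bounded operator and the weak norm *)

Section adjoint.
Context {R : realType} (F H : banachLatticeType R) (v : {linear F -> H}).
Context (cv : continuous v).

Lemma adjoint_linear (y : dual H) : linear (fun x : F => y (v x) : R^o).
Proof. by move=> a x z; rewrite linearP dual_linear. Qed.

Lemma adjoint_bound (y : dual H) x : `|y (v x)| <= (opnorm v * `|y|) * `|x|.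
Proof.
apply: le_trans (dual_le_norm _ _) _.
by rewrite [opnorm v * _]mulrC -mulrA ler_wpM2l// le_opnorm.
Qed.

Definition adjoint (y : dual H) : dual F :=
  Dual (bounded_continuous_linear (adjoint_linear y) (adjoint_bound y)).

Lemma adjoint_is_linear : linear adjoint.
Proof. by move=> a y z; apply: dualP. Qed.

Lemma adjoint_norm y : `|adjoint y| <= opnorm v * `|y|.
Proof.
apply: dual_norm_le; last exact: adjoint_bound.
by rewrite mulr_ge0// opnorm_ge0.
Qed.

Lemma adjoint_positive : positive_map v -> positive_map adjoint.
Proof. by move=> pv y y0 x x0; exact/y0/pv. Qed.

End adjoint.

Lemma wnorm_has_sup (R : realType) (G : banachLatticeType R) (r : \bar R) n
    (y : 'I_n -> G) : (1 <= r)%E ->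
  has_sup [set lpnorm r (fun i => xi (vabs (y i)) : R)
          | xi in [set xi : dual G | 0 <=L xi /\ `|xi| <= 1]].
Proof.
move=> r1; split.
  exists (lpnorm r (fun i => (0 : dual G) (vabs (y i)) : R)), 0 => //=.
  by split; [exact: vle_refl|rewrite normr0].
exists (lpnorm r (fun i => `|y i|)) => _ [xi [_ xi1] <-].
apply: lpnorm_mono => // i; rewrite normr_id -(norm_vabs (y i)).
by apply: le_trans (dual_le_norm _ _) _; rewrite -[leRHS]mul1r ler_wpM2r.
Qed.

(** Each test functional [xi] becomes [opnorm v] times [eta], the normalised composite of [xi] with
    the adjoint. Positivity of the [y i] matters: in general the adjoint does not commute with
    [vabs]. *)
Lemma wnorm_adjoint (R : realType) (F H : banachLatticeType R)
    (v : {linear F -> H}) (cv : continuous v) (r : \bar R) n (y : 'I_n -> dual H) :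
  (1 <= r)%E -> positive_map v -> (forall i, 0 <=L y i) ->
  wnorm r (fun i => adjoint cv (y i)) <= opnorm v * wnorm r y.
Proof.
move=> r1 pv y0; have V0 : 0 <= opnorm v by exact: opnorm_ge0 cv.
apply: ge_sup; first by case: (wnorm_has_sup (fun i => adjoint cv (y i)) r1).
move=> _ [xi [xi0 xi1] <-].
pose f (z : dual H) : R^o := xi (adjoint cv z).
have fV z : `|f z| <= opnorm v * `|z|.
  apply: le_trans (dual_le_norm _ _) _.
  rewrite -[leRHS]mul1r; apply: ler_pM => //.
  exact: adjoint_norm.
pose g (z : dual H) : R^o := (opnorm v)^-1 * f z.
have fE z : f z = opnorm v * g z.
  (* If [opnorm v] is 0, its inverse is 0 too, and [fV] makes [f] vanish, so the identity
     persists. *)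
  have [v0|v0] := eqVneq (opnorm v) 0; last by rewrite mulVKf.
  by apply/eqP; rewrite v0 mul0r -normr_le0; have := fV z; rewrite v0 mul0r.
have g1 z : `|g z| <= 1 * `|z|.
  rewrite normrM ger0_norm ?invr_ge0//.
  apply: le_trans (ler_wpM2l _ (fV z)) _; first by rewrite invr_ge0.
  rewrite mulrA ler_wpM2r//.
  by have [->|v0] := eqVneq (opnorm v) 0; rewrite ?mulr0// mulVf.
have lg : linear g.
  by move=> a z w; rewrite /g /f adjoint_is_linear dual_linear mulrDr mulrCA.
pose eta := Dual (bounded_continuous_linear lg g1).
have -> : (fun i => xi (vabs (adjoint cv (y i))) : R) =
          (fun i => opnorm v * eta (vabs (y i))).
  (* Both [y i] and its adjoint image are positive, so [vabs] drops out on both sides. *)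
  apply/funext => i; rewrite [eta _]/(g _) -fE !ge0_vabs//.
  exact: adjoint_positive.
rewrite lpnormZ//; apply: ler_wpM2l => //.
apply: (sup_upper_bound (wnorm_has_sup y r1)); exists eta => //; split.
  move=> z z0; rewrite [eta _]/(g _) mulr_ge0 ?invr_ge0//.
  exact/xi0/adjoint_positive.
exact: dual_norm_le.
Qed.

(** * Domination constants of the composite and passage to the infimum *)

Lemma domination_const_comp (R : realType) (p q r : \bar R) (m : nat)
    (E G : 'I_m -> banachLatticeType R) (F H : banachLatticeType R)
    (T : (forall j, E j) -> F)
    (u : forall j, {linear G j -> E j}) (v : {linear F -> H}) (C : R) :
  (1 <= q)%E -> (1 <= r)%E ->
  (forall j, continuous (u j)) -> (forall j, positive_map (u j)) ->
  continuous v -> positive_map v ->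
  0 <= C -> domination_const p q r T C ->
  domination_const p q r (fun x : forall j, G j => v (T (fun j => u j (x j))))
    (C * \prod_j opnorm (u j) * opnorm v).
Proof.
move=> q1 r1 cu pu cv pv C0 TC n x y x0 y0.
(* Moving [v] to the other side of the pairing as its adjoint leaves the left-hand side
   unchanged. *)
have := TC n (fun i j => u j (x i j)) (fun i => adjoint cv (y i)).
move=> /(_ (fun i j => pu j _ (x0 i j)) (fun i => adjoint_positive cv pv (y0 i))).
move=> /le_trans; apply.
(* Regrouping pairs the product of the [opnorm (u j)] with the supremum over forms, and [opnorm v]
   with [wnorm]. *)
have -> (a b c d e : R) : a * b * c * d * e = a * (b * d) * (c * e).
  by rewrite -!mulrA [c * (d * e)]mulrCA.
have S0 : 0 <= sup [set lpnorm q (fun i => phi (fun j => u j (x i j)) : R)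
                   | phi in positive_forms_ball (E := E)].
  by apply: sup_ge0 => _ [phi _ <-]; exact: lpnorm_ge0.
apply: ler_pM; first exact: mulr_ge0.
- by apply: sup_ge0 => _ [xi _ <-]; exact: lpnorm_ge0.
- by apply: ler_wpM2l => //; exact: sup_forms_precomp.
- exact: wnorm_adjoint.
Qed.

Lemma domination_const_le (R : realType) (p q r : \bar R) (m : nat)
    (E : 'I_m -> banachLatticeType R) (F : banachLatticeType R)
    (T : (forall j, E j) -> F) (C D : R) :
  C <= D -> domination_const p q r T C -> domination_const p q r T D.
Proof.
move=> CD TC n x y x0 y0; apply: le_trans (TC n x y x0 y0) _.
apply: ler_wpM2r; first by apply: sup_ge0 => _ [xi _ <-]; exact: lpnorm_ge0.
by apply: ler_wpM2r => //; apply: sup_ge0 => _ [phi _ <-]; exact: lpnorm_ge0.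
Qed.

Theorem proposition2p4 (R : realType) (p q r : \bar R) (m : nat)
    (E G : 'I_m -> banachLatticeType R) (F H : banachLatticeType R)
    (T : (forall j, E j) -> F)
    (u : forall j, {linear G j -> E j}) (v : {linear F -> H}) :
  (1 <= p)%E -> (1 <= q)%E -> (1 <= r)%E -> (p^-1 = q^-1 + r^-1)%E ->
  (0 < m)%N ->
  pos_weakly_dominated p q r T ->
  (forall j, continuous (u j)) -> (forall j, positive_map (u j)) ->
  continuous v -> positive_map v ->
  pos_weakly_dominated p q r
    (fun x : forall j, G j => v (T (fun j => u j (x j)))) /\
  pos_weakly_dominated_norm p q r
    (fun x : forall j, G j => v (T (fun j => u j (x j)))) <=
  pos_weakly_dominated_norm p q r T * (\prod_(j < m) opnorm (u j)) * opnorm v.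
Proof.
move=> _ q1 r1 _ _ [lT bT [C0 C00 TC0]] cu pu cv pv.
set S := fun x : forall j, G j => _; set N := \prod_j opnorm (u j).
have N0 : 0 <= N by apply: prodr_ge0 => j _; exact: opnorm_ge0 (cu j).
have V0 : 0 <= opnorm v by exact: opnorm_ge0 cv.
(* Admissible constants are strictly positive, while [C * N * opnorm v] may be 0; the summand [e]
   repairs this and is later let tend to 0. *)
have SC C e : 0 < C -> domination_const p q r T C -> 0 < e ->
    0 < C * N * opnorm v + e /\ domination_const p q r S (C * N * opnorm v + e).
  move=> C_gt0 TC e0; have C_ge0 := ltW C_gt0.
  split; first by rewrite ltr_wpDl// !mulr_ge0.
  apply: (domination_const_le (C := C * N * opnorm v)); first by rewrite lerDl ltW.
  exact: domination_const_comp.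
split.
  split.
  - by move=> j x a y z; rewrite /S (multilinear_precomp u lT) linearP.
  - have [M M0 TM] := multiboundedP bT.
    exists (opnorm v * (M * N)) => x; apply: le_trans (le_opnorm _ cv) _.
    by rewrite -mulrA ler_wpM2l//; exact: le_precomp.
  - by have [] := SC _ _ C00 TC0 ltr01; exists (C0 * N * opnorm v + 1).
set A := [set C : R | 0 < C /\ domination_const p q r S C].
have infS C : 0 < C -> domination_const p q r T C -> inf A <= C * (N * opnorm v).
  move=> C_gt0 TC; apply/ler_addgt0Pr => e e0; rewrite mulrA.
  apply: ge_inf; last exact: SC.
  (* [ge_inf] needs a lower bound of [A]; positivity of its elements supplies 0. *)
  by exists 0 => D [/ltW].
rewrite -mulrA; have := mulr_ge0 N0 V0.
(* When [N * opnorm v] is 0 no division is possible, but [infS] at the single constant [C0] already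
   gives [inf A <= 0]. *)
rewrite le_eqVlt => /predU1P[K0|K0].
  by have := infS _ C00 TC0; rewrite -K0 !mulr0.
(* Otherwise [inf A] divided by [N * opnorm v] is a lower bound of all constants of [T], hence at
   most their infimum. *)
rewrite -ler_pdivrMr//; apply: lb_le_inf; first by exists C0.
by move=> C [C_gt0 TC]; rewrite ler_pdivrMr//; exact: infS.
Qed.
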